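(* Let $G$ be a graph with an $(\alpha,\beta)$-linkage $\mathcal{P}=\{p_i\}_{i=1}^t$. If $\mathcal{P}$ is $(\alpha,\beta)$-rigid, then no path in $\mathcal{P}$ has a chord and $G$ does not have an $X$ $(\alpha,\beta)$-linkage minor for $\mathcal{P}$. Conversely, if $\mathcal{P}$ is a spanning chordless $(\alpha,\beta)$-linkage of order $2$ with no $X$ $(\alpha,\beta)$-linkage minor, then $\mathcal{P}$ is $(\alpha,\beta)$-rigid.
   Context: A linkage in $G$ is a subgraph whose components are paths (a single vertex counts as a path); its order is the number of paths; spanning means it contains all vertices of $G$. For $\alpha,\beta\subseteq V(G)$, $\mathcal{P}$ is an $(\alpha,\beta)$-linkage if $\alpha$ consists of one endpoint of each path and $\beta$ of the other endpoints (a one-vertex path has its vertex in both); write $\alpha_i\in\alpha$, $\beta_i\in\beta$ for the endpoints of $p_i$. $\mathcal{P}$ is $(\alpha,\beta)$-rigid if it is the unique $(\alpha,\beta)$-linkage in $G$. A chord of $\mathcal{P}$ is an edge of $G$ not in $\mathcal{P}$ with both endpoints on a single path of $\mathcal{P}$; $\mathcal{P}$ is chordless if it has no chord. Edges of $G$ in $\mathcal{P}$ are path edges; edges of $G$ not in $\mathcal{P}$ that are not chords are rung edges. For a chordless linkage, a linkage minor is a minor of $G$ obtained by possibly contracting some path edges and possibly deleting some rung edges; an $(\alpha,\beta)$-linkage minor is a linkage minor in which the vertices of $\alpha$ and $\beta$ retain their labels. $G$ has an $X$ $(\alpha,\beta)$-linkage minor for $\mathcal{P}$ if for two paths $p_k,p_\ell$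 of $\mathcal{P}$ there is an $(\alpha,\beta)$-linkage minor for $p_k,p_\ell$ that is isomorphic to the $4$-cycle $C_4$ (on the vertices labeled $\alpha_k,\beta_k,\alpha_\ell,\beta_\ell$, the paths becoming the edges $\alpha_k\beta_k$ and $\alpha_\ell\beta_\ell$) with $\alpha_k$ not adjacent to $\alpha_\ell$ and $\beta_k$ not adjacent to $\beta_\ell$ in $C_4$. *)

(* Defs.v *)
From mathcomp Require Import all_boot.

Set Implicit Arguments.
Unset Strict Implicit.
Unset Printing Implicit Defensive.

Record sgraph := SGraph {
  vertex :> finType;
  edge : rel vertex;
  edge_sym : symmetric edge;
  edge_irr : irreflexive edge }.

(* Undirected edges are two-element vertex sets. *)
Definition edges (G : sgraph) : {set {set G}} :=
  [set e | [exists x : G, exists y : G, edge x y && (e == [set x; y])]].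

Definition graph_iso (G H : sgraph) (f : G -> H) : Prop :=
  bijective f /\ forall x y : G, edge (f x) (f y) = edge x y.

Definition C4_rel (i j : 'I_4) : bool := (j == ordS i) || (i == ordS j).

Lemma C4_sym : symmetric C4_rel.
Proof. by move=> i j; rewrite /C4_rel orbC. Qed.

Lemma C4_irr : irreflexive C4_rel.
Proof. by case=> [[|[|[|[|i]]]] lt_i4]. Qed.

Definition C4 : sgraph := SGraph C4_sym C4_irr.

(* A path traversed from [pstart] to its other end [pend]; the one-vertex     *)
(* path has an empty [ptail]. Two traversals of one path in opposite          *)
(* directions differ as [gpath]s but have the same vertices and edges.        *)
Record gpath (G : sgraph) := GPath {
  pstart : G;
  ptail : seq G;
  gpathP : path (@edge G) pstart ptail && uniq (pstart :: ptail) }.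

Definition pend (G : sgraph) (p : gpath G) : G := last (pstart p) (ptail p).

Definition pverts (G : sgraph) (p : gpath G) : {set G} :=
  [set x in pstart p :: ptail p].

(* [zip] truncates, so it lists the pairs of consecutive vertices. *)
Definition pedges (G : sgraph) (p : gpath G) : {set {set G}} :=
  [set:: [seq [set uv.1; uv.2] | uv <- zip (pstart p :: ptail p) (ptail p)]].

Record subgraph (G : sgraph) := Subgraph {
  sverts : {set G};
  sedges : {set {set G}} }.

(* The subgraph whose components are the paths [p i], provided these are      *)
(* pairwise disjoint.                                                         *)
Definition linkage_graph (G : sgraph) (t : nat) (p : 'I_t -> gpath G) :
    subgraph G :=
  Subgraph (\bigcup_(i < t) pverts (p i)) (\bigcup_(i < t) pedges (p i)).

(* Each [p i] is traversed from its endpoint in [alpha] to the one in [beta]. *)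
Definition ab_paths (G : sgraph) (alpha beta : {set G}) (t : nat)
    (p : 'I_t -> gpath G) : Prop :=
  [/\ forall i j : 'I_t, i != j -> [disjoint pverts (p i) & pverts (p j)],
      alpha = [set pstart (p i) | i : 'I_t]
    & beta = [set pend (p i) | i : 'I_t]].

Definition ab_linkage (G : sgraph) (alpha beta : {set G})
    (P : subgraph G) : Prop :=
  exists (t : nat) (p : 'I_t -> gpath G),
    ab_paths alpha beta p /\ P = linkage_graph p.

Definition ab_rigid (G : sgraph) (alpha beta : {set G})
    (P : subgraph G) : Prop :=
  ab_linkage alpha beta P /\
  forall Q : subgraph G, ab_linkage alpha beta Q -> Q = P.

Definition spanning (G : sgraph) (P : subgraph G) : Prop :=
  sverts P = [set: G].

Section Linkage.
Variables (G : sgraph) (t : nat) (p : 'I_t -> gpath G).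

Definition chord (i : 'I_t) (e : {set G}) : bool :=
  [&& e \in edges G, e \notin sedges (linkage_graph p) & e \subset pverts (p i)].

Definition has_chord (i : 'I_t) : Prop := exists e : {set G}, chord i e.

Definition chordless : Prop := forall i : 'I_t, ~ has_chord i.

Definition rungs : {set {set G}} :=
  [set e in edges G | (e \notin sedges (linkage_graph p)) &&
                      ~~ [exists i, chord i e]].

End Linkage.

(* The minor of the induced subgraph G[S] obtained by deleting the edges in D *)
(* and contracting those in C, where the edges in C lie inside S. Its         *)
(* vertices are the contracted vertex classes; loops and parallel edges are   *)
(* discarded.                                                                 *)
Section Minor.
Variables (G : sgraph) (S : {set G}) (C D : {set {set G}}).

Definition contracted (x : G) : {set G} :=
  [set y | connect (fun u v : G => [set u; v] \in C) x y].

Definition minor_vertex := {B : {set G} | B \in [set contracted x | x in S]}.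

Definition minor_rel (A B : minor_vertex) : bool :=
  (A != B) && [exists x in val A, exists y in val B,
                 edge x y && ([set x; y] \notin D)].

Lemma minor_rel_sym : symmetric minor_rel.
Proof.
move=> A B; rewrite /minor_rel eq_sym; congr (_ && _).
by apply/exists_inP/exists_inP => -[x xA /exists_inP[y yB /andP[xy nD]]];
  exists y => //; apply/exists_inP; exists x;
  rewrite // edge_sym xy setUC nD.
Qed.

Lemma minor_rel_irr : irreflexive minor_rel.
Proof. by move=> A; rewrite /minor_rel eqxx. Qed.

Definition minor : sgraph := SGraph minor_rel_sym minor_rel_irr.

End Minor.

(* A vertex of a minor carries the label of every vertex of G that is         *)
(* contracted into it.                                                        *)
Definition has_X_minor (G : sgraph) (t : nat) (p : 'I_t -> gpath G) : Prop :=
  exists (k l : 'I_t) (C D : {set {set G}}),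
    [/\ k != l,
        C \subset pedges (p k) :|: pedges (p l),
        D \subset rungs p
      & let H := minor (pverts (p k) :|: pverts (p l)) C D in
        (exists f : H -> C4, graph_iso f) /\
        exists ak bk al bl : H,
          [/\ [/\ pstart (p k) \in val ak, pend (p k) \in val bk,
                  pstart (p l) \in val al & pend (p l) \in val bl],
              uniq [:: ak; bk; al; bl],
              edge ak bk /\ edge al bl
            & ~~ edge ak al /\ ~~ edge bk bl]].

(* Main.v *)
(* Rigidity fails as soon as a linkage can be rerouted: a chord gives a
   shortcut in its path, and an X minor gives two crossing rungs, along which
   the tails of the two paths can be exchanged.

   Conversely, two crossing rungs give an X minor, by contracting the four
   pieces into which they cut the two paths. If no two rungs cross, the ends of
   any rung separate the starts of the two paths from their ends. A path of
   another linkage that used a rung would contain both of its ends, leaving no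
   way through for a second path of that linkage. So every linkage uses path
   edges only, and hence is the given one. *)
Require Import Defs.
From mathcomp Require Import all_boot fingroup perm zify.

Set Implicit Arguments.
Unset Strict Implicit.
Unset Printing Implicit Defensive.

(** * Positions along a path, and paths cut and joined at given vertices *)

Section Paths.
Variable G : sgraph.
Implicit Types (p q : gpath G) (u v w x y z : G) (L : {set G}).

Definition pseq p : seq G := pstart p :: ptail p.

(** Off the path this takes the default value [size (pseq p)], one more than the last position. *)
Definition pos p z : nat := index z (pseq p).

Lemma pseq_uniq p : uniq (pseq p).
Proof. by case/andP: (gpathP p). Qed.

Lemma mem_pverts p z : (z \in pverts p) = (z \in pseq p).
Proof. by rewrite inE. Qed.

Lemma pstart_in p : pstart p \in pverts p.
Proof. by rewrite mem_pverts mem_head. Qed.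

Lemma pend_in p : pend p \in pverts p.
Proof. by rewrite mem_pverts mem_last. Qed.

Lemma pos_inj p : {in pverts p &, injective (pos p)}.
Proof.
move=> u v; rewrite !mem_pverts => up vp e.
by rewrite -(nth_index u up) -(nth_index u vp); congr nth.
Qed.

Lemma pos_pstart p : pos p (pstart p) = 0.
Proof. by rewrite /pos /= eqxx. Qed.

Lemma pos_pend p z : z \in pverts p -> pos p z <= pos p (pend p).
Proof.
rewrite mem_pverts -index_mem => lt_z.
by rewrite /pos [index (pend p) _]index_last ?pseq_uniq // -ltnS.
Qed.

Lemma pos_succ_edge p u v :
  v \in pverts p -> pos p v = (pos p u).+1 -> edge u v.
Proof.
rewrite mem_pverts => vp e.
have [/(pathP (pstart p)) H _] := andP (gpathP p).
have lt_v : pos p u < size (ptail p) by rewrite -ltnS -e index_mem.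
have := H _ lt_v; rewrite -[nth _ (ptail p) _]/(nth (pstart p) (pseq p) (pos p u).+1).
rewrite -e !nth_index //.
(* [u] is on the path because its position is smaller than that of [v]. *)
by rewrite -index_mem -/(pos p u) /= ltnW.
Qed.

(** Trades the [zip] encoding for consecutive positions: the [n]-th pair of the [zip] holds the
    vertices at positions [n] and [n.+1]. *)
Lemma pedgesP p (e : {set G}) :
  reflect (exists u v, [/\ u \in pverts p, v \in pverts p,
                           pos p v = (pos p u).+1 & e = [set u; v]])
          (e \in pedges p).
Proof.
have size_zip : size (zip (pseq p) (ptail p)) = size (ptail p).
  by rewrite size_zip /= (minn_idPr _).
have nth_pseq n : n < size (pseq p) ->
    nth (pstart p) (pseq p) n \in pverts p /\
    pos p (nth (pstart p) (pseq p) n) = n.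
  by move=> lt_n; rewrite mem_pverts mem_nth // /pos index_uniq ?pseq_uniq.
rewrite inE; apply: (iffP mapP) => [[uv /(nthP (pstart p, pstart p))[n]]|].
  rewrite -/(pseq p) size_zip => lt_n <- ->.
  have [up ue] := nth_pseq n (ltnW lt_n).
  have [vp ve] := nth_pseq n.+1 lt_n.
  exists (nth (pstart p) (pseq p) n), (nth (pstart p) (pseq p) n.+1).
  split=> //; first by rewrite ue ve.
  by rewrite nth_zip_cond -/(pseq p) size_zip lt_n.
move=> [u [v [up vp e_uv ->]]].
exists (u, v) => //; rewrite -/(pseq p).
have lt_u : pos p u < size (ptail p).
  by rewrite -ltnS -e_uv index_mem -mem_pverts.
have -> : (u, v) =
    nth (pstart p, pstart p) (zip (pseq p) (ptail p)) (pos p u).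
  rewrite nth_zip_cond size_zip lt_u.
  rewrite -[nth _ (ptail p) _]/(nth (pstart p) (pseq p) (pos p u).+1) -e_uv.
  by rewrite !nth_index // -mem_pverts.
by rewrite mem_nth // size_zip.
Qed.

Lemma set2_eq u v x y :
  [set u; v] = [set x; y] -> (u = x /\ v = y) \/ (u = y /\ v = x).
Proof.
move=> e.
have : u \in [set x; y] by rewrite -e set21.
have : v \in [set x; y] by rewrite -e set22.
have : x \in [set u; v] by rewrite e set21.
have : y \in [set u; v] by rewrite e set22.
by do 4!case/set2P=> ?; subst; intuition.
Qed.

Lemma pedges_pos p u v :
  [set u; v] \in pedges p ->
  [/\ u \in pverts p, v \in pverts p
    & pos p v = (pos p u).+1 \/ pos p u = (pos p v).+1].
Proof.
case/pedgesP=> x [y [xp yp e /set2_eq[[-> ->]|[-> ->]]]].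
  by split=> //; left.
by split=> //; right.
Qed.

Lemma pedges_edges p : pedges p \subset edges G.
Proof.
apply/subsetP=> e /pedgesP[u [v [_ vp e_uv ->]]]; rewrite inE.
apply/existsP; exists u; apply/existsP; exists v.
by rewrite eqxx andbT (pos_succ_edge vp e_uv).
Qed.

Lemma edgesP (e : {set G}) :
  reflect (exists u v, edge u v /\ e = [set u; v]) (e \in edges G).
Proof.
rewrite inE; apply: (iffP existsP) => [[u /existsP[v /andP[uv /eqP->]]]|].
  by exists u, v.
by move=> [u [v [uv ->]]]; exists u; apply/existsP; exists v; rewrite uv eqxx.
Qed.

(** The least position whose vertex is outside [L] is not 0, and the vertex just before it is still
    in [L]. *)
Lemma gpath_exit p L :
  pstart p \in L -> pend p \notin L ->
  exists u v, [/\ u \in pverts p, v \in pverts p, pos p v = (pos p u).+1,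
                  u \in L & v \notin L].
Proof.
move=> sL eL.
have ex_n : exists n, (n < size (pseq p)) &&
    (nth (pstart p) (pseq p) n \notin L).
  exists (pos p (pend p)); rewrite nth_index -?mem_pverts ?pend_in // eL andbT.
  by rewrite index_mem -mem_pverts pend_in.
case: (ex_minnP ex_n) => -[|n] /andP[lt_n nL] min_n; first by rewrite sL in nL.
exists (nth (pstart p) (pseq p) n), (nth (pstart p) (pseq p) n.+1).
have lt_n' := ltnW lt_n.
split=> //; rewrite ?mem_pverts ?mem_nth //.
  by rewrite /pos !index_uniq ?pseq_uniq.
apply: contraT => nL'.
by have := min_n n; rewrite lt_n' nL' ltnn => /(_ isT).
Qed.

Lemma gpath_of_seq (s : seq G) :
  s != [::] -> sorted (@edge G) s -> uniq s -> exists p, pseq p = s.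
Proof.
case: s => [//|x s] _ xs us.
have H : path (@edge G) x s && uniq (x :: s) by apply/andP.
by exists (GPath H).
Qed.

(** [r] follows [p] up to [x], crosses to [y] and continues along [q]; the fourth hypothesis keeps
    the two pieces disjoint. With [p = q] this is a shortcut along a chord; with disjoint paths it
    is half of an exchange of tails. *)
Lemma splice p q x y :
  x \in pverts p -> y \in pverts q -> edge x y ->
  (forall z, z \in pverts p -> pos p z <= pos p x ->
             z \in pverts q -> pos q y <= pos q z -> False) ->
  exists r, [/\ pstart r = pstart p, pend r = pend q,
    forall z, z \in pverts r -> (z \in pverts p /\ pos p z <= pos p x) \/
                                (z \in pverts q /\ pos q y <= pos q z)
    & [set x; y] \in pedges r].
Proof.
rewrite !mem_pverts => xp yq xy.
have sp : sorted (@edge G) (pseq p) by case/andP: (gpathP p).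
have sq : sorted (@edge G) (pseq q) by case/andP: (gpathP q).
have up := pseq_uniq p; have uq := pseq_uniq q.
have ps : pstart p = head x (pseq p) by [].
have qe : pend q = last x (pseq q) by [].
have mp z := mem_pverts p z; have mq z := mem_pverts q z.
have pp z : pos p z = index z (pseq p) by [].
have pq z : pos q z = index z (pseq q) by [].
(* The vertex sequences become variables, so that they can be split at [x] and [y]. *)
move: (pseq p) (pseq q) => s t in xp yq sp sq up uq ps qe mp mq pp pq *.
case/splitPr: xp => s1 s2 in sp up ps mp pp *.
case/splitPr: yq => t1 t2 in sq uq qe mq pq *.
have ix : pos p x = size s1.
  move: up; rewrite pp cat_uniq /= => /and3P[_ /norP[xs _] _].
  by rewrite index_cat (negPf xs) /= eqxx addn0.
have iy : pos q y = size t1.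
  move: uq; rewrite pq cat_uniq /= => /and3P[_ /norP[yt _] _].
  by rewrite index_cat (negPf yt) /= eqxx addn0.
have Hp z : z \in rcons s1 x -> z \in pverts p /\ pos p z <= pos p x.
  rewrite mem_rcons inE => /predU1P[->|zs].
    by rewrite mp mem_cat mem_head orbT.
  by rewrite mp mem_cat zs ix pp index_cat zs ltnW // index_mem.
have Hq z : z \in y :: t2 -> z \in pverts q /\ pos q y <= pos q z.
  move=> zt; rewrite mq mem_cat zt orbT iy pq index_cat; split=> //.
  move: uq; rewrite cat_uniq => /and3P[_ /hasPn/(_ _ zt)/negPf-> _].
  exact: leq_addr.
move=> disj.
have [||| r er] := @gpath_of_seq (rcons s1 x ++ y :: t2).
- by case: (s1).
- have {}sq : path (@edge G) y t2.
    move: sq; rewrite -cat_rcons; case: (t1) => [//|b t3] /=.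
    by rewrite cat_path last_rcons => /andP[].
  move: sp; rewrite -cat_rcons; case: (s1) => [|a s3] /=.
    by rewrite xy sq.
  by rewrite !cat_path last_rcons /= => /andP[-> _]; rewrite xy sq.
- rewrite cat_uniq; apply/and3P; split.
  + by move: up; rewrite -cat_rcons cat_uniq => /and3P[].
  + apply/hasPn=> z zt; apply/negP=> zs.
    have [zp lp] := Hp z zs; have [zq lq] := Hq z zt.
    exact: (disj z).
  + by move: uq; rewrite cat_uniq => /and3P[].
exists r; split.
- rewrite ps -[pstart r]/(head x (pseq r)) er.
  by case: (s1).
- rewrite qe -[pend r]/(last x (pseq r)) er.
  by rewrite !last_cat.
- move=> z; rewrite mem_pverts er mem_cat => /orP[/Hp|/Hq]; by [left|right].
- have ur := pseq_uniq r.
  apply/pedgesP; exists x, y; split=> //.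
  + by rewrite mem_pverts er mem_cat mem_rcons mem_head.
  + by rewrite mem_pverts er mem_cat mem_head orbT.
  + move: ur; rewrite /pos er cat_uniq rcons_uniq /= => /and3P[/andP[xs _]].
    case/norP=> ys _ _.
    rewrite !index_cat (negPf ys) /= eqxx addn0 size_rcons mem_rcons mem_head.
    by rewrite -cats1 index_cat (negPf xs) /= eqxx addn0.
Qed.

(** Induction on the position of [w], stepping back one vertex at a time within the segment from [z]
    to [w]. *)
Lemma gpath_connect q (e : rel G) z w :
  z \in pverts q -> w \in pverts q -> pos q z <= pos q w ->
  (forall u v, u \in pverts q -> v \in pverts q -> pos q v = (pos q u).+1 ->
     pos q z <= pos q u -> pos q v <= pos q w -> e u v) ->
  connect e z w.
Proof.
move=> zq; have [n] := ubnP (pos q w).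
elim: n w => // n IH w lt_n wq le_zw H.
have [e_zw|lt_zw] := leqP (pos q w) (pos q z).
  by rewrite (pos_inj zq wq _) //; apply/eqP; rewrite eqn_leq le_zw.
case e_w: (pos q w) lt_zw => [//|m] lt_zm.
pose v := nth z (pseq q) m.
have lt_m : m < size (pseq q).
  by apply: ltnW; rewrite -e_w index_mem -mem_pverts.
have vq : v \in pverts q by rewrite mem_pverts mem_nth.
have ev : pos q v = m by rewrite /pos index_uniq ?pseq_uniq.
apply: (connect_trans (y := v)); last first.
  by apply/connect1/H; rewrite // ?ev.
apply: IH; rewrite ?ev //; first by rewrite -ltnS -e_w.
move=> u u' uq u'q eu le_zu le_u'; apply: H => //.
by rewrite e_w; apply: leqW.
Qed.

End Paths.

(** * Reachability, contraction classes and the recognition of minors *)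

Lemma connect_ind (T : finType) (e : rel T) (P : T -> Prop) u w :
  P u -> (forall y z, P y -> e y z -> P z) -> connect e u w -> P w.
Proof.
move=> Pu Pe /connectP[s]; elim: s u Pu => [|a s IH] u Pu /=; first by move=> _ ->.
by case/andP=> /(Pe _ _ Pu) Pa /(IH _ Pa).
Qed.

Section Minors.
Variables (G : sgraph) (S : {set G}) (C D : {set {set G}}).
Let ce : rel G := fun u v => [set u; v] \in C.

Lemma contracted_sym : connect_sym ce.
Proof. by apply: sym_connect_sym => u v; rewrite /ce setUC. Qed.

Lemma mem_contracted (B : minor_vertex S C) (u : G) :
  u \in val B -> forall w, (w \in val B) = connect ce u w.
Proof.
case: B => B /= /imsetP[x _ ->]; rewrite inE => xu w.
by rewrite inE; apply: (same_connect contracted_sym xu).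
Qed.

Lemma minor_vertex_meet (A B : minor_vertex S C) (z : G) :
  z \in val A -> z \in val B -> A = B.
Proof.
move=> zA zB; apply/val_inj/setP=> w.
by rewrite (mem_contracted zA) (mem_contracted zB).
Qed.

Lemma minor_class (z : G) : z \in S -> {B : minor_vertex S C | z \in val B}.
Proof.
move=> zS; exists (exist _ (contracted C z) (imset_f _ zS)).
by rewrite /= inE connect0.
Qed.

Lemma minor_edgeP (A B : minor S C D) :
  reflect (exists x y, [/\ A != B, x \in val A, y \in val B, edge x y
                         & [set x; y] \notin D])
          (edge A B).
Proof.
apply: (iffP andP) => [[nAB /exists_inP[x xA /exists_inP[y yB /andP[xy nD]]]]|].
  by exists x, y.
move=> [x [y [nAB xA yB xy nD]]]; split=> //.
by apply/exists_inP; exists x => //; apply/exists_inP; exists y; rewrite ?xy.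
Qed.

(** A minor is identified through a labelling [g] whose fibres in [S] are the contraction classes: a
    class goes to the common label of its members, and [rep] supplies a member for each label. The
    last two hypotheses match the surviving edges between fibres with the edges of [K]. *)
Lemma minor_iso (K : sgraph) (g : G -> K) (rep : K -> G) :
  (forall a, rep a \in S) -> cancel rep g ->
  {in S &, forall z w, connect ce z w = (g z == g w)} ->
  (forall z w, z \in S -> connect ce z w -> w \in S) ->
  {in S &, forall x y, g x != g y -> edge x y -> [set x; y] \notin D ->
     edge (g x) (g y)} ->
  (forall a b : K, edge a b -> exists x y, [/\ x \in S, y \in S, g x = a, g y = b
     & edge x y /\ [set x; y] \notin D]) ->
  exists f : minor S C D -> K, graph_iso f /\
    forall (B : minor S C D) z, z \in val B -> f B = g z.
Proof.
move=> repS repK conn clos edg1 edg2.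
have ne (B : minor_vertex S C) : exists z, (z \in val B) && (z \in S).
  case: B => B /= /imsetP[x xS ->]; exists x.
  by rewrite inE connect0.
have inS (B : minor_vertex S C) z : z \in val B -> z \in S.
  case/andP: (xchooseP (ne B)) => uB uS.
  by rewrite (mem_contracted uB) => /(clos _ _ uS).
pose f (B : minor S C D) : K := g (xchoose (ne B)).
have fE (B : minor S C D) z : z \in val B -> f B = g z.
  move=> zB; case/andP: (xchooseP (ne B)) => uB uS.
  by apply/eqP; rewrite -conn ?(inS B) // -(mem_contracted uB).
exists f; split=> //.
have f_inj : injective f.
  move=> A B; have [/andP[zA zS] /andP[wB wS]] := (xchooseP (ne A), xchooseP (ne B)).
  rewrite (fE _ _ zA) (fE _ _ wB) => /eqP; rewrite -conn // => zw.
  by apply: (minor_vertex_meet (z := xchoose (ne B))); rewrite // (mem_contracted zA).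
pose h a : minor S C D := sval (minor_class (repS a)).
have hP a : rep a \in val (h a) := svalP (minor_class (repS a)).
have hK : cancel h f by move=> a; rewrite (fE _ _ (hP a)) repK.
split; first by exists h => // B; apply: f_inj; rewrite hK.
move=> A B; apply/idP/minor_edgeP.
  move=> fAB; have [x [y [xS yS gx gy [xy nD]]]] := edg2 _ _ fAB.
  have mem z (E : minor S C D) : z \in S -> g z = f E -> z \in val E.
    move=> zS gz; case/andP: (xchooseP (ne E)) => uE uS.
    by rewrite (mem_contracted uE) conn // gz eq_sym (fE _ _ uE).
  exists x, y; split=> //; try exact: mem.
  by apply: contraTneq fAB => ->; rewrite edge_irr.
move=> [x [y [nAB xA yB xy nD]]].
rewrite (fE _ _ xA) (fE _ _ yB); apply: edg1 => //.
- exact: inS xA.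
- exact: inS yB.
by rewrite -(fE _ _ xA) -(fE _ _ yB) (inj_eq f_inj).
Qed.

End Minors.

(** * Rigidity excludes chords and crossing rungs *)

Section Linkage.
Variables (G : sgraph) (alpha beta : {set G}) (t : nat) (p : 'I_t -> gpath G).
Hypothesis hp : ab_paths alpha beta p.

Lemma pverts_eq i j z : z \in pverts (p i) -> z \in pverts (p j) -> i = j.
Proof.
case: hp => disj _ _ zi zj; apply/eqP/contraT => /disj/pred0P/(_ z).
by rewrite /= zi zj.
Qed.

Lemma linkage_edge_same i j u v :
  u \in pverts (p i) -> v \in pverts (p j) ->
  [set u; v] \in sedges (linkage_graph p) -> i = j /\ [set u; v] \in pedges (p i).
Proof.
move=> ui vj /bigcupP[m _ uv]; have [um vm _] := pedges_pos uv.
have im := pverts_eq ui um; have jm := pverts_eq vj vm.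
by rewrite im jm; split.
Qed.

(** The paths [q] form a linkage with the same [alpha] and [beta], so rigidity gives it the same
    edges. The permutation [s] is the identity for a chord and a transposition for two crossing
    rungs. *)
Lemma rigid_edges (s : {perm 'I_t}) (q : 'I_t -> gpath G) :
  ab_rigid alpha beta (linkage_graph p) ->
  (forall i, pstart (q i) = pstart (p i)) ->
  (forall i, pend (q i) = pend (p (s i))) ->
  (forall i j z, z \in pverts (q i) -> z \in pverts (q j) -> i = j) ->
  forall i, pedges (q i) \subset sedges (linkage_graph p).
Proof.
case: hp => _ ha hb [_ uniq_p] qs qe qdisj i.
rewrite -(uniq_p (linkage_graph q)); first exact: bigcup_sup.
exists t, q; split=> //; split=> [j k njk||].
- apply/pred0P=> z; apply/negP=> /= /andP[zj zk].
  by rewrite (qdisj _ _ _ zj zk) eqxx in njk.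
- by rewrite ha; apply: eq_imset => j; rewrite qs.
- rewrite hb; apply/setP=> z; apply/imsetP/imsetP => -[j _ ->].
    by exists (s^-1%g j); rewrite // qe permKV.
  by exists (s j); rewrite // qe.
Qed.

Lemma rigid_chordless (i : 'I_t) :
  ab_rigid alpha beta (linkage_graph p) -> ~ has_chord p i.
Proof.
move=> rig [e /and3P[/edgesP[u [v [uv ->]]] nP /subsetP sub]] {e}.
wlog lt_uv : u v uv nP sub / pos (p i) u < pos (p i) v.
  move=> W; have ui := sub _ (set21 u v); have vi := sub _ (set22 u v).
  case: (ltngtP (pos (p i) u) (pos (p i) v)) => [/W||].
  - by apply.
  - by apply: W; rewrite 1?edge_sym // setUC.
  - by move/(pos_inj ui vi) => e; rewrite e edge_irr in uv.
have ui := sub _ (set21 u v); have vi := sub _ (set22 u v).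
(* The kept pieces of [p i] end at [u] and begin at [v]; they are disjoint because [u] comes before
   [v]. *)
have [z _ h1 _ h2|r [rs re rv ruv]] := splice ui vi uv.
  by move: (leq_trans h2 h1); rewrite leqNgt lt_uv.
pose q j := if j == i then r else p j.
have qv j z : z \in pverts (q j) -> z \in pverts (p j).
  by rewrite /q; case: eqP => // -> /rv[] [].
move/negP: nP; apply; apply: (subsetP (rigid_edges (s := 1%g) (q := q) rig _ _ _ i)).
- by move=> j; rewrite /q; case: eqP => // ->.
- by move=> j; rewrite perm1 /q; case: eqP => // ->.
- by move=> j k z /qv zj /qv; apply: pverts_eq.
- by rewrite /q eqxx.
Qed.

(** Exchange tails: [r1] runs along [p k] to [x] and on from [y'] along [p l], while [r2] runs along
    [p l] to [y] and on from [x'] along [p k]. The new linkage contains the edge from [x] to [y'],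
    which joins two different paths and so is no path edge. *)
Lemma rigid_no_crossing (k l : 'I_t) x x' y y' :
  ab_rigid alpha beta (linkage_graph p) -> k != l ->
  x \in pverts (p k) -> x' \in pverts (p k) ->
  y \in pverts (p l) -> y' \in pverts (p l) ->
  pos (p k) x < pos (p k) x' -> pos (p l) y < pos (p l) y' ->
  edge x y' -> edge x' y -> False.
Proof.
move=> rig nkl xk x'k yl y'l lt_x lt_y xy' x'y.
have [z zk _ zl _|r1 [r1s r1e r1v r1xy]] := splice xk y'l xy'.
  by rewrite (pverts_eq zk zl) eqxx in nkl.
rewrite edge_sym in x'y.
have [z zl _ zk _|r2 [r2s r2e r2v _]] := splice yl x'k x'y.
  by rewrite (pverts_eq zk zl) eqxx in nkl.
pose q j := if j == k then r1 else if j == l then r2 else p j.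
have qk : q k = r1 by rewrite /q eqxx.
have ql : q l = r2 by rewrite /q eq_sym (negPf nkl) eqxx.
have qj j : j != k -> j != l -> q j = p j by rewrite /q => /negPf-> /negPf->.
have : [set x; y'] \in sedges (linkage_graph p).
  apply: (subsetP (rigid_edges (s := tperm k l) (q := q) rig _ _ _ k)); last by rewrite qk.
  - move=> j; case: (eqVneq j k) => [->|nk]; first by rewrite qk.
    by case: (eqVneq j l) => [->|nl]; rewrite ?ql // qj.
  - move=> j; case: tpermP => [->|->|/eqP nk /eqP nl]; by rewrite ?qk ?ql ?qj.
  (* On [p k] the path [r1] stops at [x], before [r2] enters at [x']; likewise for [y] and [y'] on
     [p l]. *)
  have disj12 z : z \in pverts r1 -> z \in pverts r2 -> False.
    move=> /r1v[] [z1 le1] /r2v[] [z2 le2].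
    - by rewrite (pverts_eq z1 z2) eqxx in nkl.
    - by have := leq_ltn_trans le1 (leq_trans lt_x le2); rewrite ltnn.
    - by have := leq_ltn_trans le2 (leq_trans lt_y le1); rewrite ltnn.
    - by rewrite (pverts_eq z2 z1) eqxx in nkl.
  have r1kl z : z \in pverts r1 -> z \in pverts (p k) \/ z \in pverts (p l).
    by case/r1v=> -[? _]; [left | right].
  have r2kl z : z \in pverts r2 -> z \in pverts (p k) \/ z \in pverts (p l).
    by case/r2v=> -[? _]; [right | left].
  move=> i j z.
  case: (eqVneq i k) (eqVneq j k) => [->|nik] [->|njk] //; rewrite ?qk.
  - case: (eqVneq j l) => [->|njl]; first by rewrite ql => /disj12 H /H.
    rewrite qj // => /r1kl[] z1 zj.
      by rewrite (pverts_eq zj z1) eqxx in njk.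
    by rewrite (pverts_eq zj z1) eqxx in njl.
  - case: (eqVneq i l) => [->|nil]; first by rewrite ql => zr2 /disj12/(_ zr2).
    rewrite qj // => zi /r1kl[] z1.
      by rewrite (pverts_eq zi z1) eqxx in nik.
    by rewrite (pverts_eq zi z1) eqxx in nil.
  - case: (eqVneq i l) (eqVneq j l) => [->|nil] [->|njl] //; rewrite ?ql.
    + rewrite qj // => /r2kl[] z1 zj.
        by rewrite (pverts_eq zj z1) eqxx in njk.
      by rewrite (pverts_eq zj z1) eqxx in njl.
    + rewrite qj // => zi /r2kl[] z1.
        by rewrite (pverts_eq zi z1) eqxx in nik.
      by rewrite (pverts_eq zi z1) eqxx in nil.
    + by rewrite !qj //; apply: pverts_eq.
by case/(linkage_edge_same xk y'l) => e; rewrite e eqxx in nkl.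
Qed.

(** * Contraction classes are intervals of paths; rigidity excludes X minors *)

Section Contract.
Variables (k l : 'I_t) (C : {set {set G}}).
Hypothesis sub_C : C \subset pedges (p k) :|: pedges (p l).
Let ce : rel G := fun u v => [set u; v] \in C.

(** A contracted edge stays on its path and advances the position by at most one, so a walk from [u]
    to [w] cannot jump over [z]: if [z] were not reached, the walk would remain strictly before
    it. *)
Lemma contract_between u w z :
  u \in pverts (p k) -> connect ce u w ->
  w \in pverts (p k) /\
  (z \in pverts (p k) -> pos (p k) u <= pos (p k) z <= pos (p k) w ->
   connect ce u z).
Proof.
move=> uk uw.
have step y y' : y \in pverts (p k) -> ce y y' ->
    y' \in pverts (p k) /\ pos (p k) y' <= (pos (p k) y).+1.
  move=> yk /(subsetP sub_C)/setUP[] /pedges_pos[y1 y2 h].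
    by split=> //; case: h => -> //; rewrite -addn2 leq_addr.
  have kl := pverts_eq yk y1; rewrite kl.
  by split=> //; case: h => -> //; rewrite -addn2 leq_addr.
have wk : w \in pverts (p k).
  by apply: (connect_ind (P := fun y => y \in pverts (p k)) uk _ uw) => y y' /step H /H[].
split=> // zk /andP[le_uz le_zw]; apply/negPn/negP => nuz.
have ltP y : y \in pverts (p k) -> connect ce u y -> pos (p k) y <= pos (p k) z ->
    pos (p k) y < pos (p k) z.
  move=> yk uy; rewrite leq_eqVlt => /orP[/eqP/(pos_inj yk zk) e|//].
  by rewrite -e uy in nuz.
suff [_ _] : [/\ w \in pverts (p k), connect ce u w & pos (p k) w < pos (p k) z].
  by rewrite ltnNge le_zw.
apply: (connect_ind (P := fun y => [/\ y \in pverts (p k), connect ce u y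
  & pos (p k) y < pos (p k) z]) _ _ uw) => [|y y' [yk uy lt_y] yy'].
  by split=> //; apply: ltP.
have [y'k le_y'] := step _ _ yk yy'.
have uy' := connect_trans uy (connect1 yy').
by split=> //; apply: ltP => //; apply: leq_trans le_y' lt_y.
Qed.

End Contract.

(** Each vertex of a 4-cycle has only one other vertex that it is not adjacent to. *)
Lemma C4_degree (a b c d : C4) :
  uniq [:: a; b; c; d] -> ~~ edge a c -> edge a d.
Proof.
by case: a b c d => [[|[|[|[|?]]]] ?] // [[|[|[|[|?]]]] ?] // [[|[|[|[|?]]]] ?] //
  [[|[|[|[|?]]]] ?].
Qed.

(** In the 4-cycle [ak] must be adjacent to [bl] and [bk] to [al]. These two edges lift to edges of
    [G], which cross because the contraction classes are intervals. *)
Lemma rigid_no_X_minor : ab_rigid alpha beta (linkage_graph p) -> ~ has_X_minor p.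
Proof.
move=> rig [k [l [C [D [nkl sC sD]]]]].
move=> [[f [f_bij f_edge]] [ak [bk [al [bl [[sk ek sl el] uq _ [nak nbk]]]]]]].
have f_inj := bij_inj f_bij.
have e1 : edge ak bl.
  rewrite -f_edge; apply: (C4_degree (b := f bk) (c := f al)); last by rewrite f_edge.
  by have : uniq (map f [:: ak; bk; al; bl]) by rewrite map_inj_uniq.
have e2 : edge bk al.
  rewrite -f_edge; apply: (C4_degree (b := f ak) (c := f bl)); last by rewrite f_edge.
  have : uniq (map f [:: bk; ak; bl; al]); last by [].
  rewrite map_inj_uniq //.
  by move: uq; rewrite /= !inE !negb_or => /and4P[/and3P[? ? ?] /andP[? ?] ? _];
    rewrite eq_sym; do ![apply/andP; split] => //; rewrite eq_sym.
have [x [y' [_ xa y'b xy' _]]] := minor_edgeP _ _ e1.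
have [x' [y [_ x'b ya x'y _]]] := minor_edgeP _ _ e2.
have sC' : C \subset pedges (p l) :|: pedges (p k) by rewrite setUC.
have inv := contract_between sC; have inv' := contract_between sC'.
have nk : ak != bk by move: uq; rewrite /= inE negb_or -andbA => /andP[].
have nl : al != bl by move: uq; rewrite /= !inE => /and4P[].
(* Only membership in the path is extracted here, so the third argument is arbitrary. *)
have [xk _] := inv _ _ x (pstart_in _) (etrans (esym (mem_contracted sk x)) xa).
have [x'k _] := inv _ _ x (pend_in _) (etrans (esym (mem_contracted ek x')) x'b).
have [yl _] := inv' _ _ x (pstart_in _) (etrans (esym (mem_contracted sl y)) ya).
have [y'l _] := inv' _ _ x (pend_in _) (etrans (esym (mem_contracted el y')) y'b).
apply: (rigid_no_crossing rig nkl xk x'k yl y'l _ _ xy' x'y); rewrite ltnNge; apply/negP.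
  (* Otherwise [x'] lies between the start of [p k] and [x], which puts it in both [ak] and [bk]. *)
  move=> le_x; have [_] := inv _ _ x' (pstart_in _) (etrans (esym (mem_contracted sk x)) xa).
  move/(_ x'k); rewrite pos_pstart le_x => /(_ isT).
  rewrite -(mem_contracted sk) => x'a.
  by rewrite (minor_vertex_meet x'a x'b) eqxx in nk.
move=> le_y; have [_] := inv' _ _ y' (pstart_in _) (etrans (esym (mem_contracted sl y)) ya).
move/(_ y'l); rewrite pos_pstart le_y => /(_ isT).
rewrite -(mem_contracted sl) => y'a.
by rewrite (minor_vertex_meet y'a y'b) eqxx in nl.
Qed.

End Linkage.

(** * Two crossing rungs yield an X minor *)

Section Crossing.
Variables (G : sgraph) (alpha beta : {set G}) (t : nat) (p : 'I_t -> gpath G).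
Hypothesis hp : ab_paths alpha beta p.

(** The pieces are numbered so that the path edges left uncontracted join 0 to 1 and 2 to 3, and the
    two rungs join 1 to 2 and 0 to 3. The starts fall in pieces 0 and 2 and the ends in 1 and 3,
    opposite vertices of the cycle. *)
Lemma crossing_X_minor (k l : 'I_t) x x' y y' :
  k != l ->
  x \in pverts (p k) -> x' \in pverts (p k) ->
  y \in pverts (p l) -> y' \in pverts (p l) ->
  pos (p k) x < pos (p k) x' -> pos (p l) y < pos (p l) y' ->
  edge x y' -> edge x' y -> has_X_minor p.
Proof.
move=> nkl xk x'k yl y'l lt_x lt_y xy' x'y.
(* [g] cuts [p k] after [x] and [p l] after [y], and sends each of the four   *)
(* pieces to the vertex of [C4] that it is contracted to.                     *)
pose c (i : nat) : C4 := inord i.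
pose gk z : C4 := if pos (p k) z <= pos (p k) x then c 0 else c 1.
pose gl z : C4 := if pos (p l) z <= pos (p l) y then c 2 else c 3.
pose g z := if z \in pverts (p k) then gk z else gl z.
have cE i j : i < 4 -> j < 4 -> (c i == c j) = (i == j).
  by move=> li lj; rewrite -val_eqE /= !inordK.
have cedge i j : i < 4 -> j < 4 -> @edge C4 (c i) (c j) =
    ((j == i.+1 %% 4) || (i == j.+1 %% 4)).
  by move=> li lj; rewrite /edge /= /C4_rel -!val_eqE /= !inordK.
have gK z : z \in pverts (p k) -> g z = gk z by rewrite /g => ->.
have notk z : z \in pverts (p l) -> z \notin pverts (p k).
  by move=> zl; apply: contra nkl => zk; rewrite (pverts_eq hp zk zl).
have gL z : z \in pverts (p l) -> g z = gl z by move/notk; rewrite /g => /negPf->.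
pose PE := pedges (p k) :|: pedges (p l).
(* All path edges of the two paths are contracted, except the one at which each path is cut. *)
pose C := [set e in PE | [forall u in e, forall v in e, g u == g v]].
pose D := rungs p :\: [set [set x; y']; [set x'; y]].
pose S := pverts (p k) :|: pverts (p l).
have inC u v : [set u; v] \in PE -> g u = g v -> [set u; v] \in C.
  move=> uv e; rewrite inE uv; apply/forall_inP=> a /set2P[]->;
  by apply/forall_inP=> b /set2P[]->; rewrite ?e.
have Cg u v : [set u; v] \in C -> g u = g v.
  rewrite inE => /andP[_ /forall_inP/(_ u (set21 _ _))/forall_inP].
  by move/(_ v (set22 _ _))/eqP.
have CS u v : [set u; v] \in C -> v \in S.
  rewrite inE => /andP[/setUP[]/pedges_pos[_ h _] _]; rewrite inE h ?orbT //.
have notD u v : [set u; v] \in PE -> [set u; v] \notin D.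
  move=> uv; rewrite !inE negb_and negb_and; apply/orP; right.
  apply/orP; right; rewrite negb_and negbK; apply/orP; left.
  by case/setUP: uv => h; apply/bigcupP; [exists k | exists l].
(* Pieces are intervals, so every path edge between two vertices of one piece is contracted. *)
have kk z w : z \in pverts (p k) -> w \in pverts (p k) -> pos (p k) z <= pos (p k) w ->
    gk z = gk w -> connect (fun u v => [set u; v] \in C) z w.
  move=> zk wk le_zw e; apply: (gpath_connect zk wk le_zw) => u v uk vk euv le_zu le_vw.
  apply: inC; first by apply/setUP; left; apply/pedgesP; exists u, v.
  rewrite !gK //; move/eqP: e; rewrite /gk.
  by do 4![case: leqP => ?]; rewrite ?cE //; lia.
have ll z w : z \in pverts (p l) -> w \in pverts (p l) -> pos (p l) z <= pos (p l) w ->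
    gl z = gl w -> connect (fun u v => [set u; v] \in C) z w.
  move=> zk wk le_zw e; apply: (gpath_connect zk wk le_zw) => u v uk vk euv le_zu le_vw.
  apply: inC; first by apply/setUP; right; apply/pedgesP; exists u, v.
  rewrite !gL //; move/eqP: e; rewrite /gl.
  by do 4![case: leqP => ?]; rewrite ?cE //; lia.
have symC : connect_sym (fun u v => [set u; v] \in C).
  by apply: sym_connect_sym => u v; rewrite setUC.
(* The endpoint in each piece, in the order of the labels; the default [x] is never reached. *)
pose rep (a : C4) := nth x [:: pstart (p k); pend (p k); pstart (p l); pend (p l)] a.
have [[[sk ek] sl] el] := (pstart_in (p k), pend_in (p k), pstart_in (p l), pend_in (p l)).
have g0 : g (pstart (p k)) = c 0 by rewrite gK // /gk pos_pstart.
have g1 : g (pend (p k)) = c 1.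
  by rewrite gK // /gk leqNgt (leq_trans lt_x) // pos_pend.
have g2 : g (pstart (p l)) = c 2 by rewrite gL // /gl pos_pstart.
have g3 : g (pend (p l)) = c 3.
  by rewrite gL // /gl leqNgt (leq_trans lt_y) // pos_pend.
have [f [f_iso fE]] : exists f : minor S C D -> C4, graph_iso f /\
    forall (B : minor S C D) z, z \in val B -> f B = g z.
  apply: (minor_iso (rep := rep)).
  - by case=> [[|[|[|[|?]]]] lt] //=; rewrite inE ?sk ?ek ?sl ?el ?orbT.
  - by case=> [[|[|[|[|?]]]] lt] //=; rewrite /rep /= ?g0 ?g1 ?g2 ?g3;
      apply: val_inj; rewrite /= inordK.
  - move=> z w zS wS; apply/idP/eqP.
      by move=> zw; apply: (connect_ind (P := fun w => g z = g w) _ _ zw) => // a b -> /Cg.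
    case/setUP: zS => zi; case/setUP: wS => wi; rewrite ?(gK _ zi) ?(gL _ zi) ?(gK _ wi) ?(gL _ wi) => e.
    + by case/orP: (leq_total (pos (p k) z) (pos (p k) w)) => h; [|rewrite symC]; apply: kk.
    + by move/eqP: e; rewrite /gk /gl; do 2![case: ifP => _]; rewrite cE.
    + by move/eqP: e; rewrite /gk /gl; do 2![case: ifP => _]; rewrite cE.
    + by case/orP: (leq_total (pos (p l) z) (pos (p l) w)) => h; [|rewrite symC]; apply: ll.
  - move=> z w zS zw.
    by apply: (connect_ind (P := fun w => w \in S) _ _ zw) => // a b _ /CS.
  (* An edge between the two paths is a rung, hence deleted unless it is one of the two crossing
     ones. *)
  - have cross u v : u \in pverts (p k) -> v \in pverts (p l) -> edge u v ->
        [set u; v] \notin D -> edge (g u) (g v).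
      move=> uk vl uv; rewrite inE negb_and negbK => /orP[|].
        case/set2P=> /set2_eq[] [eu ev]; subst.
        - by rewrite (gK _ xk) (gL _ y'l) /gk /gl leqnn leqNgt lt_y cedge.
        - by move: (notk _ y'l); rewrite uk.
        - by rewrite (gK _ x'k) (gL _ yl) /gk /gl leqnn leqNgt lt_x cedge.
        - by move: (notk _ yl); rewrite uk.
      case/negP; rewrite inE; apply/and3P; split.
      + by apply/edgesP; exists u, v.
      + by apply/negP=> /(linkage_edge_same hp uk vl)[e _]; rewrite e eqxx in nkl.
      + apply/existsPn=> m; apply/negP=> /and3P[_ _ /subsetP sub].
        have um := sub _ (set21 _ _); have vm := sub _ (set22 _ _).
        by rewrite (pverts_eq hp uk um) (pverts_eq hp vl vm) eqxx in nkl.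
    move=> u v /setUP[] ui /setUP[] vi ne uv nD.
    (* Any edge with both ends on [p k] and different labels joins pieces 0 and 1, which are
       adjacent. *)
    + move: ne; rewrite !gK // /gk; do 2![case: ifP => _]; by rewrite ?eqxx // cedge.
    + exact: cross.
    + by rewrite edge_sym; apply: cross; rewrite // 1?edge_sym // setUC.
    + move: ne; rewrite !gL // /gl; do 2![case: ifP => _]; by rewrite ?eqxx // cedge.
  - pose Q a b := exists u v, [/\ u \in S, v \in S, g u = a, g v = b
      & edge u v /\ [set u; v] \notin D].
    have Qsym a b : Q a b -> Q b a.
      move=> [u [v [uS vS gu gv [uv nD]]]]; exists v, u; split=> //.
      by rewrite edge_sym setUC.
    have kS z : z \in pverts (p k) -> z \in S by rewrite in_setU => ->.
    have lS z : z \in pverts (p l) -> z \in S by rewrite in_setU orbC => ->.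
    (* The edge along which [p k] leaves its first piece. *)
    have Q01 : Q (c 0) (c 1).
      have [||u [v [uk vk euv uL vL]]] := @gpath_exit _ (p k) [set z | g z == c 0].
      - by rewrite inE g0.
      - by rewrite inE g1 cE.
      exists u, v; split; rewrite ?kS //.
      - by move: uL; rewrite inE => /eqP.
      - by move: vL; rewrite inE !gK // /gk; case: ifP; rewrite ?eqxx.
      split; first exact: (pos_succ_edge vk).
      by apply/notD/setUP; left; apply/pedgesP; exists u, v.
    have Q23 : Q (c 2) (c 3).
      have [||u [v [uk vk euv uL vL]]] := @gpath_exit _ (p l) [set z | g z == c 2].
      - by rewrite inE g2.
      - by rewrite inE g3 cE.
      exists u, v; split; rewrite ?lS //.
      - by move: uL; rewrite inE => /eqP.
      - by move: vL; rewrite inE !gL // /gl; case: ifP; rewrite ?eqxx.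
      split; first exact: (pos_succ_edge vk).
      by apply/notD/setUP; right; apply/pedgesP; exists u, v.
    have Q12 : Q (c 1) (c 2).
      exists x', y; split; [exact: kS | exact: lS | | |].
      - by rewrite gK // /gk leqNgt lt_x.
      - by rewrite gL // /gl leqnn.
      by split; rewrite // inE set22.
    have Q03 : Q (c 0) (c 3).
      exists x, y'; split; [exact: kS | exact: lS | | |].
      - by rewrite gK // /gk leqnn.
      - by rewrite gL // /gl leqNgt lt_y.
      by split; rewrite // inE set21.
    move=> a b; rewrite -/(Q a b) -[a]inord_val -[b]inord_val cedge ?ltn_ord //.
    rewrite -/(c a) -/(c b).
    by case: a b => [[|[|[|[|?]]]] ?] // [[|[|[|[|?]]]] ?] //= _; auto.
have [ak akP] := minor_class C (subsetP (subsetUl _ _) _ sk : _ \in S).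
have [bk bkP] := minor_class C (subsetP (subsetUl _ _) _ ek : _ \in S).
have [al alP] := minor_class C (subsetP (subsetUr _ _) _ sl : _ \in S).
have [bl blP] := minor_class C (subsetP (subsetUr _ _) _ el : _ \in S).
have f0 := fE _ _ akP; have f1 := fE _ _ bkP; have f2 := fE _ _ alP; have f3 := fE _ _ blP.
rewrite {}g0 {}g1 {}g2 {}g3 in f0 f1 f2 f3.
exists k, l, C, D; split=> //.
- by apply/subsetP=> e; rewrite inE => /andP[].
- exact: subsetDl.
split; first by exists f.
have [f_bij f_edge] := f_iso.
exists ak, bk, al, bl; split=> //.
- rewrite -(map_inj_uniq (bij_inj f_bij)) /= f0 f1 f2 f3 !inE !cE //.
- by rewrite -!f_edge f0 f1 f2 f3 !cedge.
- by rewrite -!f_edge f0 f1 f2 f3 !cedge.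
Qed.

End Crossing.

(** * Uniqueness of a spanning chordless linkage of order two *)

Section Converse.
Variables (G : sgraph) (alpha beta : {set G}) (t : nat) (p : 'I_t -> gpath G).
Hypothesis hp : ab_paths alpha beta p.

Lemma chordless_pedges i u v :
  chordless p -> u \in pverts (p i) -> v \in pverts (p i) -> edge u v ->
  [set u; v] \in pedges (p i).
Proof.
move=> nch ui vi uv.
have [h|h] := boolP ([set u; v] \in sedges (linkage_graph p)).
  by case: (linkage_edge_same hp ui vi h).
case: (nch i); exists [set u; v]; apply/and3P; split=> //.
  by apply/edgesP; exists u, v.
by apply/subsetP=> z /set2P[]->.
Qed.

Lemma ab_paths_start (s : nat) (q : 'I_s -> gpath G) e :
  ab_paths alpha beta q -> exists i, pstart (q e) = pstart (p i).
Proof.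
case: hp => _ ha _ [_ ha' _].
have : pstart (q e) \in alpha by rewrite ha'; apply: imset_f.
by rewrite ha => /imsetP[i _ ->]; exists i.
Qed.

Lemma ab_paths_end (s : nat) (q : 'I_s -> gpath G) e :
  ab_paths alpha beta q -> exists i, pend (q e) = pend (p i).
Proof.
case: hp => _ _ hb [_ _ hb'].
have : pend (q e) \in beta by rewrite hb'; apply: imset_f.
by rewrite hb => /imsetP[i _ ->]; exists i.
Qed.

(* Deleting the ends of the rung [uv] separates the starts of the two paths   *)
(* from their ends: only a rung crossing [uv] could join the two sides.       *)
Lemma rung_separates i j u v r w w' :
  chordless p -> ~ has_X_minor p -> (forall m : 'I_t, m = i \/ m = j) -> i != j ->
  u \in pverts (p i) -> v \in pverts (p j) -> edge u v ->
  w \in pverts (p i) -> w' \in pverts (p r) -> edge w w' ->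
  pos (p i) w < pos (p i) u -> w' != u -> w' != v ->
  (w' \in pverts (p i) /\ pos (p i) w' < pos (p i) u) \/
  (w' \in pverts (p j) /\ pos (p j) w' < pos (p j) v).
Proof.
move=> nch nX two nij ui vj uv wi w'r ww' lt_w nu nv.
case: (two r) => e; rewrite {}e {r} in w'r.
  left; split=> //.
  (* Without chords [w] and [w'] are consecutive, so the step cannot jump over [u]. *)
  have [_ _ h] := pedges_pos (chordless_pedges nch wi w'r ww').
  have : pos (p i) w' != pos (p i) u by apply: contra nu => /eqP/pos_inj->.
  by case: h; lia.
right; split=> //.
have : pos (p j) w' != pos (p j) v by apply: contra nv => /eqP/pos_inj->.
(* If [w'] came after [v], the rung from [w] to [w'] would cross the one from [u] to [v]. *)
case: ltngtP => // lt_v _; case: nX.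
exact: (crossing_X_minor hp nij wi ui vj w'r lt_w lt_v ww' uv).
Qed.

(** If the edge were a rung, a second path [q e'] would avoid both [u] and [v], yet pass from the
    starts of the two given paths to their ends, against [rung_separates]. *)
Lemma no_rung_used (s : nat) (q : 'I_s -> gpath G) e u v :
  t = 2 -> spanning (linkage_graph p) -> chordless p -> ~ has_X_minor p ->
  ab_paths alpha beta q -> [set u; v] \in pedges (q e) ->
  [set u; v] \in sedges (linkage_graph p).
Proof.
move=> t2 span nch nX hq uvq.
have inp z : exists i, z \in pverts (p i).
  have : z \in sverts (linkage_graph p) by rewrite span inE.
  by case/bigcupP=> i _; exists i.
have [[i ui] [j vj]] := (inp u, inp v).
have uv : edge u v.
  have /edgesP[x [y [xy /set2_eq[[-> ->]|[-> ->]]]]] := subsetP (pedges_edges (q e)) _ uvq.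
    by [].
  by rewrite edge_sym.
have [eij|nij] := eqVneq i j.
  rewrite -eij in vj; apply/bigcupP; exists i => //.
  exact: chordless_pedges.
have two m : m = i \/ m = j.
  suff : (m == i) || (m == j) by case/orP=> /eqP; auto.
  rewrite -!val_eqE /=; have := ltn_ord m; have := ltn_ord i; have := ltn_ord j.
  by move: nij; rewrite -val_eqE /=; lia.
have two' m : m = j \/ m = i by case: (two m); auto.
have [uq vq _] := pedges_pos uvq.
(* The starts of [p i] and [p j] are distinct starts of paths of [q], so [q] has at least two
   paths. *)
have [e' ne] : exists e', e' != e.
  case: (hp) => _ ha _; case: (hq) => _ ha' _.
  have sub m : exists e', pstart (p m) = pstart (q e').
    have : pstart (p m) \in alpha by rewrite ha; apply: imset_f.
    by rewrite ha' => /imsetP[e' _ ->]; exists e'.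
  have [[e1 h1] [e2 h2]] := (sub i, sub j).
  have [e1e|] := eqVneq e1 e; last by exists e1.
  exists e2; apply: contra nij => /eqP e2e.
  have hi := pstart_in (p i); have hj := pstart_in (p j).
  by rewrite h2 e2e -e1e -h1 in hj; rewrite (pverts_eq hp hi hj).
have avoid z : z \in pverts (q e') -> (z != u) && (z != v).
  move=> zq; apply/andP; split; apply: contra ne => /eqP ez; rewrite ez in zq.
    by rewrite (pverts_eq hq zq uq).
  by rewrite (pverts_eq hq zq vq).
pose L := [set z | (z \in pverts (p i)) && (pos (p i) z < pos (p i) u) ||
                   (z \in pverts (p j)) && (pos (p j) z < pos (p j) v)].
have [||w [w' [wq w'q eww' wL w'L]]] := @gpath_exit _ (q e') L.
(* The start of [q e'] has position 0 on [p i] or [p j]; being neither [u] nor [v], it lies strictly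
   before them. *)
- have [m em] := ab_paths_start e' hq.
  have /andP[] := avoid _ (pstart_in _); rewrite em [_ \in L]inE.
  case: (two m) => -> nu nv; rewrite pstart_in pos_pstart.
    by rewrite lt0n; apply/orP; left; apply: contra nu => /eqP h;
      apply/eqP/(pos_inj (pstart_in _) ui); rewrite pos_pstart.
  by rewrite lt0n; apply/orP; right; apply: contra nv => /eqP h;
      apply/eqP/(pos_inj (pstart_in _) vj); rewrite pos_pstart.
- have [m em] := ab_paths_end e' hq.
  rewrite em inE; apply/norP; split; apply/negP=> /andP[h]; rewrite ltnNge.
    by rewrite (pverts_eq hp (pend_in _) h) pos_pend.
  by rewrite (pverts_eq hp (pend_in _) h) pos_pend.
have ww' : edge w w' by apply: pos_succ_edge eww'.
have [r w'r] := inp w'.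
have /andP[nu nv] := avoid _ w'q.
case/negP: w'L; rewrite inE; move: wL; rewrite inE => /orP[]/andP[wm lt_w]; apply/orP.
  by case: (rung_separates nch nX two nij ui vj uv wm w'r ww' lt_w nu nv) => -[-> ->];
    [left | right].
(* The same argument with the roles of [(i, u)] and [(j, v)] exchanged. *)
rewrite eq_sym in nij; rewrite edge_sym in uv.
by case: (rung_separates nch nX two' nij vj ui uv wm w'r ww' lt_w nv nu) => -[-> ->];
  [right | left].
Qed.

(** Using path edges only, a path of [q] cannot leave the given path on which it starts. It
    therefore runs to the end of that path and traverses every edge of it. *)
Lemma ab_paths_subset_eq (s : nat) (q : 'I_s -> gpath G) :
  spanning (linkage_graph p) -> ab_paths alpha beta q ->
  (forall e, pedges (q e) \subset sedges (linkage_graph p)) ->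
  linkage_graph q = linkage_graph p.
Proof.
move=> span hq sub.
have edge_in e u v i : [set u; v] \in pedges (q e) -> u \in pverts (p i) ->
    v \in pverts (p i) /\ [set u; v] \in pedges (p i).
  move=> /(subsetP (sub e))/bigcupP[m _ uv] ui.
  have [um vm _] := pedges_pos uv.
  by rewrite (pverts_eq hp ui um).
have sup i : exists e, [/\ pstart (q e) = pstart (p i), pend (q e) = pend (p i)
    & pedges (p i) \subset pedges (q e)].
  have [e es] : exists e, pstart (q e) = pstart (p i).
    case: (hp) => _ ha _; case: (hq) => _ ha' _.
    have : pstart (p i) \in alpha by rewrite ha; apply: imset_f.
    by rewrite ha' => /imsetP[e _ ->]; exists e.
  exists e.
  have ee : pend (q e) = pend (p i).
    have [m em] := ab_paths_end e hq.
    suff : pend (q e) \in pverts (p i).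
      by rewrite em => h; rewrite (pverts_eq hp (pend_in _) h).
    apply: contraT => nE.
    have [|u [v [uq vq e_uv ui]]] := gpath_exit _ nE; first by rewrite es pstart_in.
    have uv : [set u; v] \in pedges (q e) by apply/pedgesP; exists u, v.
    by case: (edge_in _ _ _ _ uv ui) => ->.
  split=> //; apply/subsetP=> f /pedgesP[u [v [up vp e_uv ->]]].
  (* The only path edge leaving this initial segment of [p i] is the one from [u] to [v]. *)
  pose L := [set z in pverts (p i) | pos (p i) z <= pos (p i) u].
  have [||x [y [xq yq e_xy xL yL]]] := @gpath_exit _ (q e) L.
  - by rewrite es in_set pstart_in pos_pstart.
  - by rewrite ee in_set pend_in /= -ltnNge -e_uv pos_pend.
  have xy : [set x; y] \in pedges (q e) by apply/pedgesP; exists x, y.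
  move: xL; rewrite in_set => /andP[xp le_x].
  have [yp xyp] := edge_in _ _ _ _ xy xp.
  move: yL; rewrite in_set yp /= -ltnNge => lt_y.
  have [_ _ h] := pedges_pos xyp.
  have ex : pos (p i) x = pos (p i) u by case: h; lia.
  have ey : pos (p i) y = pos (p i) v by case: h; lia.
  by rewrite -(pos_inj xp up ex) -(pos_inj yp vp ey).
rewrite /linkage_graph; congr Subgraph.
  rewrite [RHS](span : \bigcup_(i < t) pverts (p i) = _).
  apply/setP=> z; rewrite inE.
  have : z \in sverts (linkage_graph p) by rewrite span inE.
  case/bigcupP=> i _ zi; have [e [es ee sube]] := sup i.
  apply/bigcupP; exists e => //.
  have [->|nz] := eqVneq z (pstart (p i)); first by rewrite -es pstart_in.
  (* A vertex [z] other than the start has a predecessor on [p i], and the edge between them belongs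
     to [q e]. *)
  have [||u [v [up vp e_uv uL vL]]] := @gpath_exit _ (p i) [set x in pverts (p i) | pos (p i) x < pos (p i) z].
  - rewrite in_set pstart_in pos_pstart lt0n.
    by apply: contra nz => /eqP h; apply/eqP/(pos_inj zi (pstart_in _)); rewrite pos_pstart.
  - by rewrite in_set pend_in -leqNgt pos_pend.
  move: uL; rewrite in_set up /= => lt_u.
  move: vL; rewrite in_set vp /= -leqNgt => le_v.
  have ez : pos (p i) v = pos (p i) z by lia.
  have : [set u; v] \in pedges (q e).
    by apply: (subsetP sube); apply/pedgesP; exists u, v.
  by rewrite (pos_inj vp zi ez) => /pedges_pos[].
apply/eqP; rewrite eqEsubset; apply/andP; split.
  by apply/bigcupsP.
apply/bigcupsP=> i _; have [e [_ _ sube]] := sup i.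
by apply: subset_trans sube _; apply: bigcup_sup.
Qed.

End Converse.

Theorem theorem2p15 (G : sgraph) (alpha beta : {set G}) (t : nat)
    (p : 'I_t -> gpath G) (hp : ab_paths alpha beta p) :
  (ab_rigid alpha beta (linkage_graph p) ->
     (forall i : 'I_t, ~ has_chord p i) /\ ~ has_X_minor p)
  /\
  (t = 2 -> spanning (linkage_graph p) -> chordless p -> ~ has_X_minor p ->
     ab_rigid alpha beta (linkage_graph p)).
Proof.
split=> [rig|t2 span nch nX].
  split; last exact: (rigid_no_X_minor hp).
  by move=> i; apply: (rigid_chordless hp).
split; first by exists t, p.
move=> Q [s [q [hq ->]]]; apply: (ab_paths_subset_eq hp span hq) => e.
apply/subsetP=> f fq; have /pedgesP[u [v [_ _ _ ef]]] := fq; subst f.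
exact: (no_rung_used hp t2 span nch nX hq fq).
Qed.
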